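(* Every affinely satisfiable set $\Gamma$ of conditions is satisfiable.
   Context: Syntax. Fix a countable set $\mathbb P$ of atomic propositions. (Affine) propositions are built inductively: $1$, every $p\in\mathbb P$, $\phi+\psi$, $r\phi$ ($r\in\mathbb R$), $\Box\phi$. A condition is an expression $\phi\leqslant\psi$ with $\phi,\psi$ propositions. Semantics. A topological model is a pair $M=(X,\mathbf v)$ with $X$ a topological space and $\mathbf v$ assigning to each $p\in\mathbb P$ an arbitrary map $\mathbf v_p:X\to[0,1]$. The value $\phi^M:X\to\mathbb R$ is defined by $1^M(x)=1$, $p^M(x)=\mathbf v_p(x)$, $(\phi+\psi)^M=\phi^M+\psi^M$, $(r\phi)^M=r\phi^M$, and $(\Box\phi)^M(x)=\sup\{\inf_{t\in U}\phi^M(t): U\ni x \text{ open}\}$ (the lower semi-continuous envelope of $\phi^M$). $M\vDash_x\phi\leqslant\psi$ means $\phi^M(x)\leqslant\psi^M(x)$; $M\vDash_x\Gamma$ means $M\vDash_x\mathcal S$ for all $\mathcal S\in\Gamma$. A set $\Gamma$ of conditions (or a single condition) is satisfiable if there are a topological model $M=(X,\mathbf v)$ and $x\in X$ with $M\vDash_x\Gamma$. The affine closure of a set $\Gamma$ of conditions is the family of all conditions of the form $r_1\phi_1+\cdots+r_k\phi_k\leqslant r_1\psi_1+\cdots+r_k\psi_k$ where each $\phi_i\leqslant\psi_i$ belongs to $\Gamma$ and each $r_i\geqslant0$. $\Gamma$ is affinely satisfiable if every condition in its affine closure is satisfiable (each one separately, possibly in different models and at different points). *)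

(* Defs.v *)
From HB Require Import structures.
From mathcomp Require Import all_boot all_order all_algebra.
From mathcomp Require Import boolp classical_sets functions reals topology.

Set Implicit Arguments.
Unset Strict Implicit.
Unset Printing Implicit Defensive.

Import Order.TTheory GRing.Theory Num.Theory.
Local Open Scope classical_set_scope.
Local Open Scope ring_scope.

Inductive proposition (R : realType) (P : countType) : Type :=
| One
| Atom of P
| Add of proposition R P & proposition R P
| Scale of R & proposition R P
| Box of proposition R P.

Arguments One {R P}.
Arguments Atom {R P} p.

Record condition (R : realType) (P : countType) : Type :=
  Condition { lhs : proposition R P; rhs : proposition R P }.

Record top_model (R : realType) (P : countType) : Type := TopModel {
  space :> topologicalType;
  valuation : P -> space -> R;
  valuation01 : forall p x, 0 <= valuation p x <= 1 }.

(* The real-valued [sup] and [inf] are the intended ones for bounded [f]; see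
   [value_bounded] below for the functions it is applied to. *)
Definition lsc_env (R : realType) (X : topologicalType) (f : X -> R) (x : X) : R :=
  sup [set inf (f @` U) | U in open_nbhs x].

Fixpoint value (R : realType) (P : countType) (M : top_model R P)
    (phi : proposition R P) : M -> R :=
  match phi with
  | One => fun=> 1
  | Atom p => valuation p
  | Add phi1 phi2 => fun x => value phi1 x + value phi2 x
  | Scale r phi1 => fun x => r * value phi1 x
  | Box phi1 => lsc_env (value phi1)
  end.

Definition satisfies (R : realType) (P : countType) (M : top_model R P) (x : M)
    (Gamma : set (condition R P)) : Prop :=
  forall S, Gamma S -> value (lhs S) x <= value (rhs S) x.

Definition satisfiable (R : realType) (P : countType)
    (Gamma : set (condition R P)) : Prop :=
  exists (M : top_model R P) (x : M), satisfies x Gamma.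

(* The formal expression r_0 phi_0 + ... + r_k phi_k, with k.+1 terms (there is
   no empty sum of propositions), bracketed to the left. *)
Fixpoint lincomb (R : realType) (P : countType) (r : nat -> R)
    (phi : nat -> proposition R P) (k : nat) : proposition R P :=
  if k is j.+1 then Add (lincomb r phi j) (Scale (r k) (phi k))
  else Scale (r 0%N) (phi 0%N).

Definition affine_closure (R : realType) (P : countType)
    (Gamma : set (condition R P)) : set (condition R P) :=
  [set S | exists (k : nat) (r : nat -> R) (C : nat -> condition R P),
     (forall i, (i <= k)%N -> Gamma (C i) /\ 0 <= r i) /\
     S = Condition (lincomb r (fun i => lhs (C i)) k)
                   (lincomb r (fun i => rhs (C i)) k)].

Definition affinely_satisfiable (R : realType) (P : countType)
    (Gamma : set (condition R P)) : Prop :=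
  forall S, affine_closure Gamma S -> satisfiable [set S].

Lemma lsc_env_bounded (R : realType) (X : topologicalType) (f : X -> R) (B : R) :
  (forall x, `|f x| <= B) -> forall x, `|lsc_env f x| <= B.
Proof.
move=> fB x.
have infB U : open_nbhs x U -> `|inf (f @` U)| <= B.
  move=> [_ Ux]; rewrite ler_norml; apply/andP; split.
    apply: lb_le_inf; first by exists (f x), x.
    by move=> _ [y _ <-]; have := fB y; rewrite ler_norml => /andP[].
  have fxB : f x <= B by have := fB x; rewrite ler_norml => /andP[].
  apply: le_trans fxB; apply: ge_inf; last by exists x.
  by exists (- B) => _ [y _ <-]; have := fB y; rewrite ler_norml => /andP[].
have xT : open_nbhs x setT by split; [exact: openT|].
rewrite /lsc_env ler_norml; apply/andP; split.
  apply: (@le_trans _ _ (inf (f @` setT))).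
    by have := infB _ xT; rewrite ler_norml => /andP[].
  apply: ub_le_sup; last by exists setT.
  by exists B => _ [U xU <-]; have := infB _ xU; rewrite ler_norml => /andP[].
apply: ge_sup; first by exists (inf (f @` setT)), setT.
by move=> _ [U xU <-]; have := infB _ xU; rewrite ler_norml => /andP[].
Qed.

Lemma value_bounded (R : realType) (P : countType) (M : top_model R P)
    (phi : proposition R P) :
  exists B : R, forall x : M, `|value phi x| <= B.
Proof.
elim: phi => [|p|phi [B phiB] psi [C psiC]|r phi [B phiB]|phi [B phiB]] /=.
- by exists 1 => x; rewrite normr1.
- by exists 1 => x; have /andP[v0 v1] := valuation01 p x; rewrite ger0_norm.
- by exists (B + C) => x; apply: le_trans (ler_normD _ _) _; exact: lerD.
- by exists (`|r| * B) => x; rewrite normrM ler_wpM2l.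
- by exists B; exact: lsc_env_bounded.
Qed.

(* Main.v *)
Require Import Defs.
From HB Require Import structures.
From mathcomp Require Import all_boot all_order all_algebra.
From mathcomp Require Import boolp classical_sets functions reals topology.
From mathcomp Require Import lra.

(** Let [I] index the affine closure of [Gamma], and choose for each [i : I] a
pointed model [(M i, x i)] of the i-th condition. The proof averages all these
pointed models into a single one.

The average is governed by a mean [L]: a positive normalized linear functional
on the bounded functions [I -> R]. The averaged model [ultramean M L] lives on
the product of the spaces [M i] with the box topology, and an atom takes at [x]
the value [L (fun i => valuation p (x i))]. The theorem [value_ultramean], a
Los theorem for affine formulas, says that the same formula computes the value
of every proposition. Linear connectives commute with [L] since [L] is linear.
The modality commutes with [L] since a box neighbourhood constrains the
coordinates independently: both a neighbourhood on which the i-th function is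
almost bounded below by its envelope, and a point at which it almost descends to
its envelope, can be chosen coordinate by coordinate with the same error in all
coordinates, and a mean preserves a uniform error.

The averaged point is a model of [Gamma] as soon as [L] is nonnegative on the
gap functions [fun i => value (rhs S) (x i) - value (lhs S) (x i)], for [S] in
[Gamma]. The convex cone spanned by these consists of the gap functions of the
conditions in the affine closure, so each of its members is nonnegative at some
index, namely at its own one: this is affine satisfiability. By the Hahn-Banach
theorem such a cone admits a mean that is nonnegative on it
([exists_mean_ge0_on_cone]). The Hahn-Banach theorem itself is obtained by
showing that a minimal sublinear functional is linear. *)

Set Implicit Arguments.
Unset Strict Implicit.
Unset Printing Implicit Defensive.

Import Order.TTheory GRing.Theory Num.Theory.
Local Open Scope classical_set_scope.
Local Open Scope ring_scope.

(** * The Hahn-Banach theorem *)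

Definition sublinear (R : realType) (V : lmodType R) (q : V -> R) : Prop :=
  (forall u v, q (u + v) <= q u + q v) /\
  (forall a u, 0 <= a -> q (a *: u) <= a * q u).

Lemma sublinear0 (R : realType) (V : lmodType R) (q : V -> R) :
  sublinear q -> q 0 = 0.
Proof.
move=> [qD qZ]; apply/eqP; rewrite eq_le; apply/andP; split.
  by have := qZ 0 0 (lexx _); rewrite scale0r mul0r.
by have := qD 0 0; rewrite addr0; lra.
Qed.

Lemma sublinearZ (R : realType) (V : lmodType R) (q : V -> R) (a : R) (u : V) :
  sublinear q -> 0 <= a -> q (a *: u) = a * q u.
Proof.
move=> sq; rewrite le_eqVlt => /predU1P[<-|a0].
  by rewrite scale0r mul0r sublinear0.
apply/eqP; rewrite eq_le (sq.2 _ _ (ltW a0)) /=.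
have := sq.2 a^-1 (a *: u); rewrite invr_ge0 ltW// => /(_ isT).
by rewrite scalerA mulVf ?gt_eqF// scale1r ler_pdivlMl.
Qed.

Lemma sublinearN (R : realType) (V : lmodType R) (q : V -> R) (u : V) :
  sublinear q -> - q (- u) <= q u.
Proof. by move=> sq; have := sq.1 u (- u); rewrite subrr sublinear0//; lra. Qed.

(** The last two hypotheses allow another member of the family on the left, so that
this covers infima of chains, infima of perturbations of one functional,
and the functional attached to a convex cone. *)
Lemma sublinear_inf (R : realType) (V : lmodType R) (J : Type) (j0 : J)
    (F : J -> V -> R) :
  (forall v, has_lbound [set F j v | j in setT]) ->
  (forall j k u v, exists l, F l (u + v) <= F j u + F k v) ->
  (forall a j u, 0 <= a -> exists l, F l (a *: u) <= a * F j u) ->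
  sublinear (fun v => inf [set F j v | j in setT]).
Proof.
move=> Flb FD FZ.
have Finf_le v j : inf [set F k v | k in setT] <= F j v.
  by apply: ge_inf; [exact: Flb|exists j].
have le_Finf v c : (forall j, c <= F j v) -> c <= inf [set F k v | k in setT].
  by move=> cF; apply: lb_le_inf; [exists (F j0 v), j0|move=> _ [j _ <-]].
split=> [u v|a u a0].
  rewrite -lerBlDr; apply/le_Finf => j; rewrite lerBlDl -lerBlDr.
  apply/le_Finf => k; rewrite lerBlDr.
  rewrite [leRHS]addrC; have [l lD] := FD j k u v.
  exact: le_trans (Finf_le _ _) lD.
have infZ j : inf [set F k (a *: u) | k in setT] <= a * F j u.
  by have [l lZ] := FZ a j u a0; exact: le_trans (Finf_le _ _) lZ.
(* For [a = 0] one cannot divide by [a], but any single [j] gives the bound. *)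
move: a0; rewrite le_eqVlt => /predU1P[a0|a0].
  by rewrite -a0 mul0r; have := infZ j0; rewrite -a0 mul0r.
rewrite mulrC -ler_pdivrMr//; apply/le_Finf => j.
by rewrite ler_pdivrMr// mulrC.
Qed.

(** The functional [q' v = inf_(t >= 0) (q (v + t h) - t q h)] is sublinear and
below [q], hence equal to [q] by minimality; its term at [t = 1] then bounds
[q u] by [q (u + h) - q h]. *)
Lemma minimal_sublinear_superadditive (R : realType) (V : lmodType R)
    (q : V -> R) :
  sublinear q ->
  (forall q', sublinear q' -> (forall v, q' v <= q v) -> q' = q) ->
  forall u h, q u + q h <= q (u + h).
Proof.
move=> sq qmin u h.
pose F (t : {t : R | 0 <= t}) v := q (v + val t *: h) - val t * q h.
have Flb v : has_lbound [set F t v | t in setT].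
  exists (- q (- v)) => _ [[t t0] _ <-]; rewrite /F /=.
  by have := sq.1 (v + t *: h) (- v); rewrite addrAC subrr add0r sublinearZ//; lra.
pose q' v := inf [set F t v | t in setT].
have F0 : 0 <= 0 :> R by [].
have sq' : sublinear q'.
  apply: (sublinear_inf (exist _ 0 F0)) => //.
    move=> [s s0] [t t0] v w; exists (exist _ (s + t) (addr_ge0 s0 t0)).
    rewrite /F /=; have := sq.1 (v + s *: h) (w + t *: h).
    by rewrite addrACA -scalerDl mulrDl; lra.
  move=> a [t t0] v a0; exists (exist _ (a * t) (mulr_ge0 a0 t0)).
  rewrite /F /=; have := sq.2 a (v + t *: h) a0.
  by rewrite scalerDr scalerA mulrBr mulrA; lra.
have q'F t v : q' v <= F t v by apply: ge_inf; [exact: Flb|exists t].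
have q'q : q' = q.
  apply: qmin => // v; have := q'F (exist _ 0 F0) v.
  by rewrite /F /= scale0r addr0 mul0r subr0.
have := q'F (exist _ 1 ler01) u; rewrite q'q /F /= scale1r mul1r; lra.
Qed.

(** Zorn's lemma provides a minimal sublinear functional below [p], and such a
functional is additive. *)
Theorem hahn_banach (R : realType) (V : lmodType R) (p : V -> R) :
  sublinear p ->
  exists L : V -> R, [/\ forall u v, L (u + v) = L u + L v,
    forall a u, L (a *: u) = a * L u & forall v, L v <= p v].
Proof.
move=> sp.
pose dom (q : V -> R) := sublinear q /\ forall v, q v <= p v.
pose T := {q : V -> R | dom q}.
pose below (q1 q2 : T) := `[< forall v, sval q2 v <= sval q1 v >].
have [|q1 q2 q3|[q1 ?] [q2 ?]|A Atot|q qmax] := @Zorn T below.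
- by move=> q; apply/asboolP.
- move=> /asboolP le12 /asboolP le23; apply/asboolP => v.
  exact: le_trans (le23 v) (le12 v).
- move=> /asboolP le12 /asboolP le21; apply: eq_exist.
  by apply/funext => v; apply/eqP; rewrite eq_le le12 le21.
- have [A0|/nonemptyPn A0] := pselect (A !=set0); last first.
    by exists (exist dom p (conj sp (fun=> lexx _))) => q; rewrite A0.
  have [q0 Aq0] := A0.
  pose F (q : {q : T | A q}) v := sval (sval q) v.
  (* Every sublinear [q] below [p] satisfies [q v >= - q (- v) >= - p (- v)]. *)
  have Flb v : has_lbound [set F q v | q in setT].
    exists (- p (- v)) => _ [[[q [sq qp]] Aq] _ <-]; rewrite /F /=.
    by have := sublinearN v sq; have := qp (- v); lra.
  have Fp q v : inf [set F q v | q in setT] <= F q v.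
    by apply: ge_inf; [exact: Flb|exists q].
  have sF : sublinear (fun v => inf [set F q v | q in setT]).
    apply: (sublinear_inf (exist _ q0 Aq0)) => //.
      move=> [[q [sq qp]] Aq] [[q' [sq' qp']] Aq'] u v; rewrite /F /=.
      have [/asboolP/= le_q|/asboolP/= le_q] := Atot _ _ Aq Aq'.
        exists (exist _ _ Aq') => /=.
        by have := sq'.1 u v; have := le_q u; lra.
      exists (exist _ _ Aq) => /=.
      by have := sq.1 u v; have := le_q v; lra.
    move=> a [[q [sq qp]] Aq] u a0; exists (exist _ _ Aq).
    exact: sq.2.
  have Fle v : inf [set F q v | q in setT] <= p v.
    by apply: le_trans (Fp (exist _ q0 Aq0) v) _; exact: (svalP q0).2.
  exists (exist dom _ (conj sF Fle)) => q Aq; apply/asboolP => v /=.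
  exact: (Fp (exist _ q Aq)).
case: q qmax => q [sq qp] qmax.
have qmin q' : sublinear q' -> (forall v, q' v <= q v) -> q' = q.
  move=> sq' q'q.
  have q'p v : q' v <= p v by apply: le_trans (q'q v) (qp v).
  pose s' : T := exist dom q' (conj sq' q'p).
  by have /(congr1 sval) := qmax s' (asboolT q'q).
have qD u v : q (u + v) = q u + q v.
  by apply/eqP; rewrite eq_le sq.1 minimal_sublinear_superadditive.
have qN u : q (- u) = - q u.
  by have := qD u (- u); rewrite subrr sublinear0//; lra.
exists q; split=> // a u; have [a0|a0] := leP 0 a; first exact: sublinearZ.
rewrite -[a]opprK scaleNr qN sublinearZ ?mulNr// oppr_ge0; exact: ltW.
Qed.

(** * Means on bounded functions *)

Definition bounded (R : realType) (I : Type) (f : I -> R) : Prop :=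
  exists B, forall i, `|f i| <= B.

Lemma boundedD (R : realType) (I : Type) (f g : I -> R) :
  bounded f -> bounded g -> bounded (fun i => f i + g i).
Proof.
move=> [B fB] [C gC]; exists (B + C) => i.
by apply: le_trans (ler_normD _ _) _; exact: lerD.
Qed.

Lemma boundedB (R : realType) (I : Type) (f g : I -> R) :
  bounded f -> bounded g -> bounded (fun i => f i - g i).
Proof.
move=> [B fB] [C gC]; exists (B + C) => i.
by apply: le_trans (ler_normB _ _) _; exact: lerD.
Qed.

Lemma boundedZ (R : realType) (I : Type) (a : R) (f : I -> R) :
  bounded f -> bounded (fun i => a * f i).
Proof. by move=> [B fB]; exists (`|a| * B) => i; rewrite normrM ler_wpM2l. Qed.

Lemma bounded_cst (R : realType) (I : Type) (c : R) :
  bounded (fun _ : I => c).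
Proof. by exists `|c|. Qed.

Section BoundedFunctions.
Variables (R : realType) (I : Type).

Definition boundedb : {pred I -> R^o} := fun f => `[< bounded f >].

Lemma boundedb_submod : submod_closed boundedb.
Proof.
split=> [|a f g /asboolP fb /asboolP gb]; apply/asboolP.
  exact: bounded_cst.
exact: boundedD (boundedZ a fb) gb.
Qed.

HB.instance Definition _ :=
  GRing.isSubmodClosed.Build R (I -> R^o) boundedb boundedb_submod.

(** A bundled module, because a sublinear functional must be total on a vector
space and a supremum is sublinear on bounded functions only. *)
Record bounded_function := BoundedFunction {
  bounded_val :> I -> R^o;
  bounded_valP : bounded_val \in boundedb }.

HB.instance Definition _ := [isSub for bounded_val].
HB.instance Definition _ := [Choice of bounded_function by <:].
HB.instance Definition _ := [SubChoice_isSubLmodule of bounded_function by <:].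

Lemma bounded_function_ext (u v : bounded_function) :
  (forall i, u i = v i :> R) -> u = v.
Proof. by move=> uv; apply: val_inj; apply/funext. Qed.

Lemma bounded_valD (u v : bounded_function) i : (u + v) i = u i + v i :> R.
Proof. by []. Qed.

Lemma bounded_valN (u : bounded_function) i : (- u) i = - u i :> R.
Proof. by []. Qed.

Lemma bounded_valZ a (u : bounded_function) i : (a *: u) i = a * u i :> R.
Proof. by []. Qed.

End BoundedFunctions.

(** A mean is an integral against a finitely additive probability. It is a total
function, with its laws restricted to bounded arguments, so that it can be
applied to a family of values before a bound on it is proved. *)
Record mean (R : realType) (I : Type) : Type := Mean {
  mean_val :> (I -> R) -> R;
  meanD : forall f g, bounded f -> bounded g ->
    mean_val (fun i => f i + g i) = mean_val f + mean_val g;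
  meanZ : forall a f, bounded f -> mean_val (fun i => a * f i) = a * mean_val f;
  mean_ge0 : forall f, bounded f -> (forall i, 0 <= f i) -> 0 <= mean_val f;
  mean1 : mean_val (fun=> 1) = 1 }.

Section MeanTheory.
Variables (R : realType) (I : Type) (L : mean R I).

Lemma meanB f g : bounded f -> bounded g -> L (fun i => f i - g i) = L f - L g.
Proof.
move=> fb gb; rewrite -[L g]mul1r -mulNr -meanZ// -meanD//; last exact: boundedZ.
by congr (L _); apply/funext => i; rewrite mulN1r.
Qed.

Lemma mean_cst c : L (fun=> c) = c.
Proof.
rewrite -[RHS]mulr1 -[X in _ = _ * X](mean1 L) -meanZ; last exact: bounded_cst.
by congr (L _); apply/funext => i; rewrite mulr1.
Qed.

Lemma le_mean f g :
  bounded f -> bounded g -> (forall i, f i <= g i) -> L f <= L g.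
Proof.
move=> fb gb fg; rewrite -subr_ge0 -meanB//; apply: mean_ge0.
  exact: boundedB.
by move=> i; rewrite subr_ge0.
Qed.

End MeanTheory.

(** The functional [p g = inf_(f in C) sup (g + f)] is sublinear because [C] is
a convex cone, and it is finite because every [f] in [C] is nonnegative
somewhere, so that [sup (g + f)] is at least a lower bound of [g]. A linear
[L <= p] satisfies [L g <= sup g] by taking [f = 0], which makes it positive
and normalized, and [L (- f) <= sup (- f + f) = 0] for [f] in [C]. *)
Lemma exists_mean_ge0_on_cone (R : realType) (I : Type) (C : set (I -> R)) :
  C (fun=> 0) ->
  (forall f g, C f -> C g -> C (fun i => f i + g i)) ->
  (forall a f, 0 <= a -> C f -> C (fun i => a * f i)) ->
  (forall f, C f -> bounded f) ->
  (forall f, C f -> exists i, 0 <= f i) ->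
  exists L : mean R I, forall f, C f -> 0 <= L f.
Proof.
move=> C0 CD CZ Cb Cge0.
have [i0 _] := Cge0 _ C0.
pose F (f : {f : I -> R | C f}) (g : bounded_function R I) :=
  sup [set g i + sval f i | i in setT].
have Vb (g : bounded_function R I) : bounded g.
  by apply/asboolP; exact: bounded_valP.
have le_F f (g : bounded_function R I) i : g i + sval f i <= F f g.
  have [B gfB] := boundedD (Vb g) (Cb _ (svalP f)).
  apply: ub_le_sup; last by exists i.
  by exists B => _ [j _ <-]; apply: le_trans (ler_norm _) (gfB j).
have F_le f (g : bounded_function R I) c :
    (forall i, g i + sval f i <= c) -> F f g <= c.
  move=> gfc; apply: ge_sup; first by exists (g i0 + sval f i0), i0.
  by move=> _ [i _ <-].
have Flb (g : bounded_function R I) : has_lbound [set F f g | f in setT].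
  have [B gB] := Vb g; exists (- B) => _ [f _ <-].
  have [i fi0] := Cge0 _ (svalP f); apply: le_trans (le_F f g i).
  by have := gB i; rewrite ler_norml => /andP[? _]; rewrite -[- B]addr0 lerD.
pose p (g : bounded_function R I) := inf [set F f g | f in setT].
have pF f g : p g <= F f g by apply: ge_inf; [exact: Flb|exists f].
have sp : sublinear p.
  apply: (sublinear_inf (exist _ _ C0)) => //.
    move=> [f Cf] [f' Cf'] u v; exists (exist _ _ (CD _ _ Cf Cf')).
    apply: F_le => i; rewrite bounded_valD /= addrACA.
    by apply: lerD; [exact: (le_F (exist _ f Cf))|exact: (le_F (exist _ f' Cf'))].
  move=> a [f Cf] u a0; exists (exist _ _ (CZ _ _ a0 Cf)).
  apply: F_le => i; rewrite bounded_valZ /= -mulrDr ler_wpM2l//.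
  exact: (le_F (exist _ f Cf)).
have [L [LD LZ Lp]] := hahn_banach sp.
have L_le (g : bounded_function R I) c : (forall i, g i <= c) -> L g <= c.
  move=> gc; apply: le_trans (Lp _) _; apply: le_trans (pF (exist _ _ C0) _) _.
  by apply: F_le => i; rewrite addr0.
have LN (g : bounded_function R I) : L (- g) = - L g.
  by rewrite -scaleN1r LZ mulN1r.
(* Unbounded functions are sent to the zero vector. *)
pose B (f : I -> R) : bounded_function R I := insubd 0 (f : I -> R^o).
have BE f : bounded f -> B f = f :> (I -> R).
  by move=> fb; rewrite -[LHS]/(val (B f)) insubdK//; apply/asboolP.
have BD f g : bounded f -> bounded g -> B (fun i => f i + g i) = B f + B g.
  move=> fb gb; apply: bounded_function_ext => i.
  by rewrite bounded_valD !BE//; exact: boundedD.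
have BZ a f : bounded f -> B (fun i => a * f i) = a *: B f.
  move=> fb; apply: bounded_function_ext => i.
  by rewrite bounded_valZ !BE//; exact: boundedZ.
have mD f g : bounded f -> bounded g ->
    L (B (fun i => f i + g i)) = L (B f) + L (B g).
  by move=> fb gb; rewrite BD// LD.
have mZ a f : bounded f -> L (B (fun i => a * f i)) = a * L (B f).
  by move=> fb; rewrite BZ// LZ.
have m0 f : bounded f -> (forall i, 0 <= f i) -> 0 <= L (B f).
  move=> fb f0; rewrite -oppr_le0 -LN; apply: L_le => i.
  by rewrite bounded_valN BE// oppr_le0.
have m1 : L (B (fun=> 1)) = 1.
  have b1 := bounded_cst I (1 : R).
  apply/eqP; rewrite eq_le; apply/andP; split; first by apply: L_le => i; rewrite BE.
  rewrite -lerN2 -LN; apply: L_le => i.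
  by rewrite bounded_valN BE.
exists (Mean mD mZ m0 m1) => f Cf /=.
rewrite -oppr_le0 -LN; apply: le_trans (Lp _) _.
apply: le_trans (pF (exist _ f Cf) _) _; apply: F_le => i.
by rewrite bounded_valN /= BE ?addNr//; exact: Cb.
Qed.

(** * The lower semi-continuous envelope *)

Section LscEnvelope.
Variables (R : realType) (X : topologicalType) (f : X -> R).
Hypothesis fb : bounded f.

Let inf_le U y : U y -> inf (f @` U) <= f y.
Proof.
move=> Uy; apply: ge_inf; last by exists y.
have [B fB] := fb.
by exists (- B) => _ [z _ <-]; have := fB z; rewrite ler_norml => /andP[].
Qed.

Let inf_le_lsc x U : open_nbhs x U -> inf (f @` U) <= lsc_env f x.
Proof.
move=> xU; apply: ub_le_sup; last by exists U.
by exists (f x) => _ [V [_ Vx] <-]; exact: inf_le.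
Qed.

Lemma lsc_env_ge x U c :
  open_nbhs x U -> (forall y, U y -> c <= f y) -> c <= lsc_env f x.
Proof.
move=> xU cf; apply: le_trans (inf_le_lsc xU).
apply: lb_le_inf; first by exists (f x), x => //; case: xU.
by move=> _ [y Uy <-]; exact: cf.
Qed.

Lemma lsc_env_le x c :
  (forall U, open_nbhs x U -> exists2 y, U y & f y <= c) -> lsc_env f x <= c.
Proof.
move=> fc; apply: ge_sup.
  by exists (inf (f @` setT)), setT => //; split; [exact: openT|].
by move=> _ [U /fc[y Uy fyc] <-]; apply: le_trans fyc; exact: inf_le.
Qed.

Lemma lsc_env_near_lb x e : 0 < e ->
  exists2 U, open_nbhs x U & forall y, U y -> lsc_env f x - e <= f y.
Proof.
move=> e0.
have [|_ [U xU <-] ltU] := sup_adherent e0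
    (_ : has_sup [set inf (f @` U) | U in open_nbhs x]).
  split; first by exists (inf (f @` setT)), setT => //; split; [exact: openT|].
  by exists (f x) => _ [V [_ Vx] <-]; exact: inf_le.
by exists U => // y Uy; apply: le_trans (ltW ltU) _; exact: inf_le.
Qed.

Lemma lsc_env_near_witness x U e : open_nbhs x U -> 0 < e ->
  exists2 y, U y & f y <= lsc_env f x + e.
Proof.
move=> xU e0; have [|_ [y Uy <-] lty] := inf_adherent e0 (_ : has_inf (f @` U)).
  split; first by exists (f x), x => //; case: xU.
  have [B fB] := fb.
  by exists (- B) => _ [z _ <-]; have := fB z; rewrite ler_norml => /andP[].
exists y => //; apply: le_trans (ltW lty) _; rewrite lerD2r; exact: inf_le_lsc.
Qed.

End LscEnvelope.

(** * The box topology *)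

(** An alias, which keeps the box topology apart from the product topology. *)
Definition box_prod (I : Type) (K : I -> topologicalType) : Type :=
  forall i, K i.

Section BoxTopology.
Variables (I : Type) (K : I -> topologicalType).

HB.instance Definition _ := gen_eqMixin (box_prod K).
HB.instance Definition _ := gen_choiceMixin (box_prod K).

Definition box_open (A : set (box_prod K)) : Prop :=
  forall x, A x -> exists2 O : forall i, set (K i),
    (forall i, open_nbhs (x i) (O i)) & forall y, (forall i, O i (y i)) -> A y.

Let box_openT : box_open setT.
Proof. by move=> x _; exists (fun=> setT) => // i; split; [exact: openT|]. Qed.

Let box_openI : setI_closed box_open.
Proof.
move=> A B Ao Bo x [/Ao[O xO OA] /Bo[O' xO' O'B]].
exists (fun i => O i `&` O' i) => [i|y yO].
  exact: open_nbhsI.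
by split; [apply: OA|apply: O'B] => i; have [] := yO i.
Qed.

Let box_open_bigU (J : Type) (A : J -> set (box_prod K)) :
  (forall j, box_open (A j)) -> box_open (\bigcup_j A j).
Proof.
move=> Ao x [j _ /Ao[O xO OA]]; exists O => // y /OA Ay.
by exists j.
Qed.

HB.instance Definition _ :=
  isOpenTopological.Build (box_prod K) box_openT box_openI box_open_bigU.

Lemma open_boxE (A : set (box_prod K)) : open A = box_open A.
Proof. by []. Qed.

End BoxTopology.

(** * The mean of a family of models *)

(** The bound depends on the proposition only; this is what makes the family of
values in a family of models a bounded function of the index. *)
Lemma value_uniformly_bounded (R : realType) (P : countType)
    (phi : proposition R P) :
  exists B : R, forall (M : top_model R P) (x : M), `|value phi x| <= B.
Proof.
elim: phi => [|p|phi [B phiB] psi [C psiC]|r phi [B phiB]|phi [B phiB]] /=.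
- by exists 1 => M x; rewrite normr1.
- by exists 1 => M x; have /andP[v0 v1] := valuation01 p x; rewrite ger0_norm.
- by exists (B + C) => M x; apply: le_trans (ler_normD _ _) _; exact: lerD.
- by exists (`|r| * B) => M x; rewrite normrM ler_wpM2l.
- by exists B => M; exact: lsc_env_bounded.
Qed.

Section Ultramean.
Variables (R : realType) (P : countType) (I : Type) (M : I -> top_model R P).
Variable L : mean R I.

Lemma bounded_values (phi : proposition R P) (x : forall i, M i) :
  bounded (fun i => value phi (x i)).
Proof. by have [B phiB] := value_uniformly_bounded phi; exists B. Qed.

Lemma mean_valuation01 p (x : box_prod (fun i => M i)) :
  0 <= L (fun i => valuation p (x i)) <= 1.
Proof.
have bv := bounded_values (Atom p) x.
rewrite mean_ge0//=; last by move=> i; have /andP[] := valuation01 p (x i).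
rewrite -[leRHS](mean1 L); apply: le_mean => //; first exact: bounded_cst.
by move=> i; have /andP[] := valuation01 p (x i).
Qed.

(** The affine analogue of an ultraproduct, with a mean for an ultrafilter. *)
Definition ultramean : top_model R P := TopModel mean_valuation01.

(** For the modality, both inequalities hold up to every [e > 0]: a
neighbourhood of [x] contains a box, in which a point can be picked whose i-th
coordinate nearly realizes the i-th envelope; conversely the neighbourhoods on
which the i-th function nearly dominates its envelope at [x i] form a box. *)
Theorem value_ultramean (phi : proposition R P) (x : ultramean) :
  value phi x = L (fun i => value phi (x i)).
Proof.
elim: phi x => [|p|phi IHphi psi IHpsi|r phi IHphi|phi IHphi] x /=.
- by rewrite mean1.
- by [].
- by rewrite IHphi IHpsi meanD//; exact: bounded_values.
- by rewrite IHphi meanZ//; exact: bounded_values.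
have phib : bounded (@value _ _ ultramean phi).
  by have [B phiB] := value_uniformly_bounded phi; exists B => y; exact: phiB.
have phiib i : bounded (@value _ _ (M i) phi).
  by have [B phiB] := value_uniformly_bounded phi; exists B => y; exact: phiB.
have boxb := bounded_values (Box phi) x; rewrite /= in boxb.
apply/eqP; rewrite eq_le; apply/andP; split; apply/ler_addgt0Pr => e e0.
- apply: lsc_env_le => // U [/(_ x)Uo Ux].
  have [O xO OU] := Uo Ux.
  pose y : ultramean := fun i =>
    s2val (cid2 (lsc_env_near_witness (phiib i) (xO i) e0)).
  exists y; first by apply: OU => i; rewrite /y; case: cid2.
  rewrite IHphi -[e](mean_cst L) -meanD//; last exact: bounded_cst.
  apply: le_mean; [exact: bounded_values|exact: boundedD (bounded_cst _ _)|].
  by move=> i; rewrite /y; case: cid2.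
- pose O i := s2val (cid2 (lsc_env_near_lb (phiib i) (x i) e0)).
  have xO i : open_nbhs (x i) (O i) by rewrite /O; case: cid2.
  have lO i y : O i y -> lsc_env (value phi) (x i) - e <= value phi y.
    by rewrite /O; case: cid2 => U _ /= /(_ y).
  pose box := [set y : ultramean | forall i, O i (y i)].
  rewrite -lerBlDr; apply: (@lsc_env_ge _ _ _ _ _ box) => //.
    split; last by move=> i; have [] := xO i.
    rewrite open_boxE => y yO; exists O => // i.
    by split; [have [] := xO i|exact: yO].
  move=> y yO; rewrite IHphi -[e](mean_cst L) -meanB//; last exact: bounded_cst.
  apply: le_mean; [exact: boundedD (bounded_cst _ _)|exact: bounded_values|].
  by move=> i; exact: lO.
Qed.

End Ultramean.

(** * The cone of gap functions of the affine closure *)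

Definition gap (R : realType) (P : countType) (S : condition R P)
    (M : top_model R P) (x : M) : R :=
  value (rhs S) x - value (lhs S) x.

Lemma value_lincomb (R : realType) (P : countType) (M : top_model R P) (x : M)
    (r : nat -> R) (phi : nat -> proposition R P) (k : nat) :
  value (lincomb r phi k) x = \sum_(i < k.+1) r i * value (phi i) x.
Proof.
elim: k => [|k IHk] /=; first by rewrite big_ord_recl big_ord0 addr0.
by rewrite big_ord_recr /= IHk.
Qed.

Lemma gap_lincomb (R : realType) (P : countType) (M : top_model R P) (x : M)
    (r : nat -> R) (C : nat -> condition R P) (k : nat) :
  gap (Condition (lincomb r (fun i => lhs (C i)) k)
                 (lincomb r (fun i => rhs (C i)) k)) x =
  \sum_(i < k.+1) r i * gap (C i) x.
Proof.
rewrite /gap /= !value_lincomb -sumrB.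
by apply: eq_bigr => i _; rewrite mulrBr.
Qed.

Section AffineClosure.
Variables (R : realType) (P : countType) (Gamma : set (condition R P)).

(** The three lemmas below say that, up to equality of gaps in all models, the
affine closure is a convex cone containing [Gamma]. Gaps are compared rather than
conditions because [Scale 1 phi] differs from [phi], and a sum of two linear
combinations is in general not bracketed to the left. *)
Lemma affine_closure_incl S : Gamma S ->
  exists2 T, affine_closure Gamma T &
    forall (M : top_model R P) (x : M), gap T x = gap S x.
Proof.
move=> GS; eexists; first by exists 0%N, (fun=> 1), (fun=> S); split.
by move=> M x; rewrite gap_lincomb big_ord_recl big_ord0 addr0 mul1r.
Qed.

Lemma affine_closureZ a S : 0 <= a -> affine_closure Gamma S ->
  exists2 T, affine_closure Gamma T &
    forall (M : top_model R P) (x : M), gap T x = a * gap S x.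
Proof.
move=> a0 [k [r [C [rC ->]]]]; eexists.
  exists k, (fun i => a * r i), C; split=> // i /rC[? ?].
  by rewrite mulr_ge0.
move=> M x; rewrite !gap_lincomb big_distrr /=.
by apply: eq_bigr => i _; rewrite mulrA.
Qed.

Lemma affine_closureD S S' : affine_closure Gamma S -> affine_closure Gamma S' ->
  exists2 T, affine_closure Gamma T &
    forall (M : top_model R P) (x : M), gap T x = gap S x + gap S' x.
Proof.
move=> [k [r [C [rC ->]]]] [k' [r' [C' [rC' ->]]]].
(* The sums have [k.+1] and [k'.+1] terms, the concatenation [k + k'.+1].+1. *)
pose app T (s s' : nat -> T) i := if (i < k.+1)%N then s i else s' (i - k.+1)%N.
eexists.
  exists (k + k'.+1)%N, (app _ r r'), (app _ C C'); split=> // i ik.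
  rewrite /app; case: ltnP => ki; first exact: rC.
  by apply: rC'; rewrite leq_subLR addSnnS.
move=> M x; rewrite !gap_lincomb -addSn big_split_ord /=.
congr (_ + _); apply: eq_bigr => i _.
  by rewrite /app ltn_ord.
by rewrite /app ltnNge leq_addr addKn.
Qed.

End AffineClosure.

(** * Affine compactness *)

Theorem theorem5p2 (R : realType) (P : countType) (Gamma : set (condition R P)) :
  affinely_satisfiable Gamma -> satisfiable Gamma.
Proof.
(* An empty [Gamma] has an empty affine closure, hence no model to average. *)
move=> Gsat; have [[S0 GS0]|/nonemptyPn G0] := pselect (Gamma !=set0); last first.
  have v01 (p : P) (b : bool) : 0 <= (0 : R) <= 1 by rewrite lexx ler01.
  by exists (TopModel v01), true => S; rewrite G0.
pose I := {S | affine_closure Gamma S}.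
have sat (i : I) : exists (M : top_model R P) (x : M), 0 <= gap (sval i) x.
  have [M [x Mx]] := Gsat _ (svalP i); exists M, x.
  by rewrite subr_ge0; exact: Mx.
pose M i := sval (cid (sat i)).
pose x i : M i := sval (cid (svalP (cid (sat i)))).
have x_ge0 i : 0 <= gap (sval i) (x i) := svalP (cid (svalP (cid (sat i)))).
pose C := [set f | exists2 S, affine_closure Gamma S & f = fun i => gap S (x i)].
have gapb S : bounded (fun i => gap S (x i)).
  by apply: boundedB; exact: bounded_values.
have [||||| L L_ge0] := @exists_mean_ge0_on_cone R I C.
- have [T GT _] := affine_closure_incl GS0.
  have [T' GT' TE] := affine_closureZ (lexx 0) GT.
  by exists T' => //; apply/funext => i; rewrite TE mul0r.
- move=> _ _ [S GS ->] [S' GS' ->].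
  have [T GT TE] := affine_closureD GS GS'.
  by exists T => //; apply/funext => i; rewrite TE.
- move=> a _ a0 [S GS ->]; have [T GT TE] := affine_closureZ a0 GS.
  by exists T => //; apply/funext => i; rewrite TE.
- by move=> _ [S _ ->].
- by move=> _ [S GS ->]; exists (exist _ S GS); exact: (x_ge0 (exist _ S GS)).
exists (ultramean M L), x => S GS; rewrite !value_ultramean -subr_ge0.
rewrite -meanB; [|exact: bounded_values|exact: bounded_values].
apply: L_ge0; have [T GT TE] := affine_closure_incl GS.
by exists T => //; apply/funext => i; rewrite TE.
Qed.
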